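(* Let $Q(n)$ be the number of $n$-quasigroups of order $4$ on the set $A=\{0,1,2,3\}$. Then for every natural number $n\ge 1$, $$Q(n) \leq 4 \cdot 6^n \cdot 4^{2^n - n - 1},$$ and the right-hand side equals $2^{2^{n+1} + O(n)}$ as $n\to\infty$.
   Context: Let $A=\{0,1,2,3\}$. For a natural number $n$, an $n$-quasigroup (of order $4$) is a pair $(A,q)$ where $q:A^n\to A$ satisfies $q(c)\neq q(c')$ for all $c,c'\in A^n$ that differ in exactly one coordinate. $Q(n)$ denotes the number of different $n$-quasigroups $(A,q)$, i.e. the number of such maps $q$ (not up to equivalence). *)

(* Defs.v *)
From HB Require Import structures.
From mathcomp Require Import all_boot all_order all_algebra.

Set Implicit Arguments.
Unset Strict Implicit.
Unset Printing Implicit Defensive.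

Definition word (n : nat) := {ffun 'I_n -> 'I_4}.

Definition differ_in_one (n : nat) (c c' : word n) : bool :=
  #|[set i | c i != c' i]| == 1.

Definition is_quasigroup (n : nat) (q : {ffun word n -> 'I_4}) : bool :=
  [forall c : word n, forall c' : word n,
     differ_in_one c c' ==> (q c != q c')].

(* Operations are finite functions, so they are counted as maps, not up to
   equivalence. *)
Definition Q (n : nat) : nat :=
  #|[set q : {ffun word n -> 'I_4} | is_quasigroup q]|.

(* Main.v *)
Require Import Defs.
From HB Require Import structures.
From mathcomp Require Import all_boot all_order all_algebra.
From Stdlib Require Import FunctionalExtensionality.

Set Implicit Arguments.
Unset Strict Implicit.
Unset Printing Implicit Defensive.

Import Order.TTheory GRing.Theory Num.Theory.

(** Split the words by their support [T].  Given the values of a quasigroup on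
    all words of smaller support, there are 4 choices on the words of support [T]
    if [T] is empty, 6 if [T] is a singleton, and at most 4 otherwise; the product
    over all [T] is the bound.

    For the last claim view the alphabet as the Klein group [V] and, by an isotopy,
    make [q] the identity on every axis.
    If [q] agrees with the sum of the coordinates as soon as one coordinate is 0,
    then it differs from the sum, if at all, by a constant [a] on the box of all
    words avoiding 0 and [a]; so there are 4 such [q].
    In general induct on [#|T|].  If fixing a coordinate to some [a != 0] separates the
    extensions, the induction hypothesis applies.  Otherwise for each [a != 0] two
    distinct extensions agree on the layer of [a]; this forces [q] to be the sum
    modulo [a] on the words constant on their support, and all three [a] together
    force [q] to be the sum on all words having a coordinate 0.

    As for the asymptotics, the bound equals [4 ^ (2 ^ n) * (3 / 2) ^ n]. *)

(** * Exhaustive checks over the Klein group *)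

Local Open Scope ring_scope.

Notation V := (bool * bool)%type.

Lemma addVV (x : V) : x + x = 0.
Proof. by case: x => [[] []]. Qed.

Definition allV (P : V -> bool) : bool :=
  [&& P (false, false), P (false, true), P (true, false) & P (true, true)].

Lemma allVP (P : V -> bool) : allV P -> forall v, P v.
Proof. by case/and4P=> ? ? ? ? [[] []]. Qed.

Definition table (T : Type) (a b c d : T) (v : V) : T :=
  if v.1 then (if v.2 then d else c) else (if v.2 then b else a).

Lemma tableE (T : Type) (f : V -> T) :
  table (f (false, false)) (f (false, true)) (f (true, false)) (f (true, true))
  = f.
Proof. by apply: functional_extensionality => -[[] []]. Qed.

Definition all_inj (P : (V -> V) -> bool) : bool :=
  allV (fun a => allV (fun b => if a == b then true else allV (fun c =>
  if (a == c) || (b == c) then true else allV (fun d =>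
  if [|| a == d, b == d | c == d] then true else P (table a b c d))))).

Lemma all_injP (P : (V -> V) -> bool) :
  all_inj P -> forall f, injective f -> P f.
Proof.
move=> H f fI.
have N u v : u != v -> (f u == f v) = false by rewrite (inj_eq fI) => /negbTE.
move/allVP/(_ (f (false, false)))/allVP/(_ (f (false, true))): H; rewrite N //.
move/allVP/(_ (f (true, false))); rewrite !N //=.
by move/allVP/(_ (f (true, true))); rewrite !N //= tableE.
Qed.

Definition disj_rows (f g : V -> V) : bool := allV (fun t => f t != g t).

Lemma disj_rowsP (f g : V -> V) : (forall t, f t <> g t) -> disj_rows f g.
Proof. by move=> H; apply/and4P; split; apply/eqP. Qed.

(* Each row is tested against the previous ones as soon as it is chosen, so that
   the exhaustive search stays small. *)
Lemma linear_square_chk :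
 all_inj (fun f1 => if (f1 0 == (false, true)) && disj_rows id f1 then
 all_inj (fun f2 => if [&& f2 0 == (true, false), disj_rows id f2 & disj_rows f1 f2] then
 all_inj (fun f3 => if [&& f3 0 == (true, true), disj_rows id f3, disj_rows f1 f3
                        & disj_rows f2 f3] then
   let f := table id f1 f2 f3 in
   allV (fun s => allV (fun t => let a := f s t + (s + t) in
     if a == 0 then true else
     [&& s != a, t != a & allV (fun s' => allV (fun t' =>
       if [&& s' != 0, s' != a, t' != 0 & t' != a]
       then f s' t' == s' + t' + a else true))])) else true)
   else true) else true).
Proof. by vm_compute. Qed.

(** Adding [f 0 0] to all values reduces to a Latin square whose first row and column are the
    identity. There are four: the addition table of [V], and three others, each obtained from it by
    adding some [a != 0] on the 2 by 2 block avoiding 0 and [a]. *)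
Lemma linear_square (f : V -> V -> V) :
  (forall s, injective (f s)) -> (forall t, injective (f^~ t)) ->
  (forall s, f s 0 = f 0 0 + s) -> (forall t, f 0 t = f 0 0 + t) ->
  forall s t, let a := f s t + (f 0 0 + s + t) in a != 0 ->
  [/\ s != a, t != a & forall s' t', s' != 0 -> s' != a -> t' != 0 -> t' != a ->
      f s' t' = f 0 0 + s' + t' + a].
Proof.
move=> fI fI' f0 f0' s t; set c := f 0 0; pose g s t := f s t + c.
have gI s' : injective (g s') by move=> x y /addIr /fI.
have gI' t' : injective (g^~ t') by move=> x y /addIr /fI'.
have g0 s' : g s' 0 = s' by rewrite /g f0 -/c addrAC addVV add0r.
have g0' : g 0 = id.
  by apply: functional_extensionality => t'; rewrite /g f0' -/c addrAC addVV add0r.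
have fE s' t' : f s' t' = g s' t' + c by rewrite /g -addrA addVV addr0.
have D x y : x != y -> disj_rows (g x) (g y).
  by move=> /eqP xy; apply: disj_rowsP => t' /(gI' t').
have D0 x : 0 != x -> disj_rows id (g x) by move=> /D; rewrite g0'.
have gT : table id (g (false, true)) (g (true, false)) (g (true, true)) = g.
  by rewrite -[RHS]tableE; congr table; apply: esym; apply: g0'.
move/all_injP/(_ _ (gI (false, true))): linear_square_chk; rewrite g0 eqxx D0 //.
move/all_injP/(_ _ (gI (true, false))); rewrite g0 eqxx D0 ?D //.
move/all_injP/(_ _ (gI (true, true))); rewrite g0 eqxx D0 ?D //.
rewrite gT /= => /allVP/(_ s)/allVP/(_ t).
have -> : f s t + (c + s + t) = g s t + (s + t) by rewrite fE -!addrA (addrA c) addVV add0r.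
set a := g s t + (s + t) => /= H /negbTE a0; move: H; rewrite a0.
case/and3P=> sa ta /allVP H; split=> // s' t' s0 s1 t0 t1.
move/allVP/(_ t'): (H s'); rewrite s0 s1 t0 t1 /= => /eqP E.
by rewrite fE E addrC !addrA.
Qed.

Lemma line_swap_chk :
  all_inj (fun f => all_inj (fun g => if f 0 == g 0 then allV (fun a =>
   if (a == 0) || (f a != g a) then true else allV (fun u =>
   if (u == 0) || (u == a) then true else (g u == f u) || (g u == f (u + a)))) else true)).
Proof. by vm_compute. Qed.

(** Both permutations send the pair [u], [u + a] onto the two values not taken at 0 and [a]. *)
Lemma line_swap (f g : V -> V) (a u : V) : injective f -> injective g ->
  f 0 = g 0 -> f a = g a -> a != 0 -> u != 0 -> u != a ->
  g u = f u \/ g u = f (u + a).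
Proof.
move=> fI gI E0 /eqP Ea /negbTE a0 /negbTE u0 /negbTE ua.
move/all_injP/(_ _ fI)/all_injP/(_ _ gI): line_swap_chk; rewrite E0 eqxx.
move/allVP/(_ a); rewrite a0 Ea /= => /allVP/(_ u); rewrite u0 ua /=.
by case/orP=> /eqP; [left|right].
Qed.

Lemma two_rows_chk :
  all_inj (fun f => all_inj (fun h => if disj_rows f h then all_inj (fun g =>
   if (g 0 == f 0) && allV (fun t => (g t == f t) || (g t == h t)) then
   allV (fun t => if g t == f t then true else
     ~~ allV (fun t' => ~~ [&& t' != 0, t' != t, g t' != f t' &
     (f t' == f t) && (h t' == h t) || (f t' == h t) && (h t' == f t)]))
   else true) else true)).
Proof. by vm_compute. Qed.

(** Write [h] as a permutation [p] without fixed points followed by [f]. Injectivity of [g] makes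
    the set where [g] differs from [f] invariant under [p]; it contains [t] but not 0, so it is a
    2-cycle, and [t'] is the partner of [t]. *)
Lemma two_rows (f h g : V -> V) (t : V) :
  injective f -> injective h -> injective g -> (forall t, f t <> h t) ->
  g 0 = f 0 -> (forall t, g t = f t \/ g t = h t) -> g t != f t ->
  exists t', [/\ t' != 0, t' != t, g t' != f t' &
    (f t' = f t /\ h t' = h t) \/ (f t' = h t /\ h t' = f t)].
Proof.
move=> fI hI gI fh g0 gE /negbTE gt.
move/all_injP/(_ _ fI)/all_injP/(_ _ hI): two_rows_chk; rewrite disj_rowsP //.
move/all_injP/(_ _ gI); rewrite g0 eqxx.
have -> /= : allV (fun t => (g t == f t) || (g t == h t)).
  by apply/and4P; split; apply/orP;
    [have := gE (false, false)|have := gE (false, true)|have := gE (true, false)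
    |have := gE (true, true)] => -[] ->; rewrite eqxx; [left|right|left|right|left|right|left|right].
move/allVP/(_ t); rewrite gt.
case: (pickP [pred t' | [&& t' != 0, t' != t, g t' != f t' &
     (f t' == f t) && (h t' == h t) || (f t' == h t) && (h t' == f t)]]) => [t' /= /and4P[h1 h2 h3 h4] _|N].
  exists t'; split=> //.
  by case/orP: h4 => /andP[/eqP -> /eqP ->]; [left|right].
have N' v := negbT (N v).
case/negP; apply/and4P; split;
  [exact: (N' (false, false))|exact: (N' (false, true))
  |exact: (N' (true, false))|exact: (N' (true, true))].
Qed.

Lemma pair_compl_chk :
  all_inj (fun f => allV (fun p1 => allV (fun p2 => if p1 == p2 then true else
    let m v := (v == p1) || (v == p2) in
    allV (fun t => allV (fun t' => allV (fun t'' =>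
      if [&& t != t', t'' != t, t'' != t' & m (f t) == m (f t')] then m (f t'') == ~~ m (f t)
      else true)))))).
Proof. by vm_compute. Qed.

(** A permutation meets a given pair at exactly two of its four arguments, so two arguments of equal
    status leave the opposite status to the other two. *)
Lemma pair_compl (f : V -> V) (p1 p2 t t' t'' : V) : injective f -> p1 != p2 ->
  t != t' -> t'' != t -> t'' != t' ->
  (f t \in [:: p1; p2]) = (f t' \in [:: p1; p2]) ->
  (f t'' \in [:: p1; p2]) = (f t \notin [:: p1; p2]).
Proof.
move=> fI /negbTE p12 h1 h2 h3; rewrite !inE => /eqP E.
move/all_injP/(_ _ fI)/allVP/(_ p1)/allVP/(_ p2): pair_compl_chk.
by rewrite p12 /= => /allVP/(_ t)/allVP/(_ t')/allVP/(_ t''); rewrite h1 h2 h3 E => /eqP.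
Qed.

(** * Extensions of a quasigroup from its zero faces *)

Definition upd (I : finType) (A : Type) (x : {ffun I -> A}) (i : I) (t : A) :
    {ffun I -> A} := [ffun j => if j == i then t else x j].

Lemma upd_id (I : finType) (A : Type) (x : {ffun I -> A}) (i : I) : upd x i (x i) = x.
Proof. by apply/ffunP=> j; rewrite ffunE; case: eqP => [->|]. Qed.

Lemma upd_same (I : finType) (A : Type) (x : {ffun I -> A}) (i : I) (t : A) :
  upd x i t i = t.
Proof. by rewrite ffunE eqxx. Qed.

Lemma upd_other (I : finType) (A : Type) (x : {ffun I -> A}) (i j : I) (t : A) :
  j != i -> upd x i t j = x j.
Proof. by rewrite ffunE => /negbTE ->. Qed.

Lemma updC (I : finType) (A : Type) (x : {ffun I -> A}) (i j : I) (s t : A) :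
  i != j -> upd (upd x i s) j t = upd (upd x j t) i s.
Proof.
move=> ij; apply/ffunP=> k; rewrite !ffunE.
by case: (k =P j) => [->|//]; rewrite eq_sym (negbTE ij).
Qed.

Lemma walk (I : finType) (A : Type) (T : {set I}) (y : {ffun I -> A})
    (P : {ffun I -> A} -> Prop) :
  (forall x i, i \in T -> P x -> P (upd x i (y i))) ->
  forall x, P x -> P [ffun i => if i \in T then y i else x i].
Proof.
move=> H x Px.
have Pr (r : seq I) : {subset r <= T} -> P [ffun i => if i \in r then y i else x i].
  elim: r => [|i r IH] rT.
    suff -> : [ffun i => if i \in [::] then y i else x i] = x by [].
    by apply/ffunP=> i; rewrite ffunE.
  have := H _ i (rT i (mem_head _ _)) (IH (fun j jr => rT j (mem_behead (s := i :: r) jr))).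
  set u := upd _ _ _; suff -> : u = [ffun j => if j \in i :: r then y j else x j] by [].
  apply/ffunP=> j; rewrite !ffunE in_cons.
  by case: eqP => [->|].
suff -> : [ffun i => if i \in T then y i else x i]
        = [ffun i => if i \in enum T then y i else x i].
  by apply: Pr => i; rewrite mem_enum.
by apply/ffunP=> i; rewrite !ffunE mem_enum.
Qed.

(** Words always range over all of [I]; the first clause makes [q] a function of the coordinates in
    [S] alone, so that passing to a face needs no change of type. *)
Definition quasi (I : finType) (S : {set I}) (q : {ffun I -> V} -> V) : Prop :=
  (forall x y : {ffun I -> V}, {in S, x =1 y} -> q x = q y) /\
  (forall x i, i \in S -> injective (fun t => q (upd x i t))).

Definition ell (I : finType) (S : {set I}) (x : {ffun I -> V}) : V :=
  \sum_(i in S) x i.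

Lemma ell_upd (I : finType) (S : {set I}) (x : {ffun I -> V}) (i : I) (t : V) :
  i \in S -> ell S (upd x i t) = ell S x + x i + t.
Proof.
move=> iS; rewrite /ell (bigD1 i) //= upd_same [in RHS](bigD1 i) //=.
rewrite [x i + _ + x i]addrAC addVV add0r addrC; congr (_ + _).
by apply: eq_bigr => j /andP[_ ji]; rewrite upd_other.
Qed.

Definition boxed (I : finType) (T : {set I}) (a : V) (x : {ffun I -> V}) : bool :=
  [forall i in T, (x i != 0) && (x i != a)].

Lemma other_elt (I : finType) (T : {set I}) (i : I) :
  (1 < #|T|)%N -> exists2 j, j \in T & j != i.
Proof.
move=> T2; have /card_gt0P[j] : (0 < #|T :\ i|)%N.
  by move: T2; rewrite (cardsD1 i T); case: (i \in T) => //= /ltnW.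
by rewrite !inE => /andP[ji jT]; exists j.
Qed.

(** A nonzero difference [a] from the sum propagates: planes through such a point are squares as in
    [linear_square], and walking coordinate by coordinate fills the box of [a]. Any two boxes share
    a word, so only one [a] occurs. *)
Lemma zero_faces_linear (I : finType) (T : {set I}) (q : {ffun I -> V} -> V) :
  (1 < #|T|)%N -> quasi T q ->
  (forall (x : {ffun I -> V}) i, i \in T -> x i = 0 -> q x = ell T x) ->
  exists a, forall x, q x = ell T x + (if boxed T a x then a else 0).
Proof.
move=> T2 [qdep qlat] q0.
have step (x : {ffun I -> V}) i a : i \in T -> q x = ell T x + a -> a != 0 ->
    [/\ x i != 0, x i != a &
    forall t, t != 0 -> t != a -> q (upd x i t) = ell T (upd x i t) + a].
  move=> iT qx a0; have [j jT ji] := other_elt i T2.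
  pose f s t := q (upd (upd x i s) j t).
  have ellE s t : ell T (upd (upd x i s) j t) = ell T x + x i + x j + s + t.
    rewrite ell_upd // ell_upd // upd_other //.
    by congr (_ + _); rewrite addrAC.
  have fI s : injective (f s) by apply: qlat.
  have fI' t : injective (f^~ t).
    by move=> u v; rewrite /f !(updC _ _ _ (_ : i != j)) 1?eq_sym //; apply: qlat.
  have fs s : f s 0 = ell T x + x i + x j + s.
    by rewrite /f (q0 _ j) ?upd_same // ellE addr0.
  have ft t : f 0 t = ell T x + x i + x j + t.
    rewrite /f (q0 _ i) ?ellE ?addr0 // upd_other ?upd_same //.
    by rewrite eq_sym.
  have f00 : f 0 0 = ell T x + x i + x j by rewrite fs addr0.
  have fx : f (x i) (x j) = q x.
    by rewrite /f !upd_id.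
  have aE : f (x i) (x j) + (f 0 0 + x i + x j) = a.
    rewrite fx f00 qx; move: (ell T x) (x i) (x j) a {qx a0}.
    by do 4! move=> [[] []].
  have := @linear_square f fI fI' _ _ (x i) (x j).
  rewrite /= aE => /(_ _ _ a0)[].
  - by move=> s; rewrite fs f00.
  - by move=> t; rewrite ft f00.
  move=> xi xj H; have [xi0 xj0] : x i != 0 /\ x j != 0.
    split; apply: contra_neq a0 => /(q0 x _ _) E; move: qx.
    - by rewrite E // -{1}[ell T x]addr0 => /addrI.
    - by rewrite E // -{1}[ell T x]addr0 => /addrI.
  split=> // t t0 ta; have := H t (x j) t0 ta xj0 xj.
  rewrite f00 /f -{1}(upd_other x t ji) upd_id => ->.
  rewrite ell_upd //; move: (ell T x) (x i) (x j) a t {qx a0 ta t0 aE H xi xi0 xj xj0 fx f00 ft fs ellE}.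
  by do 5! move=> [[] []].
have spread x a : q x = ell T x + a -> a != 0 -> boxed T a x /\
    forall y, boxed T a y -> q y = ell T y + a.
  move=> qx a0; split.
    by apply/forall_inP=> i iT; have [-> ->] := step _ _ _ iT qx a0.
  move=> y /forall_inP yB.
  pose z := [ffun i => if i \in T then y i else x i].
  have zy : {in T, z =1 y} by move=> i iT; rewrite ffunE iT.
  rewrite -(qdep _ _ zy) (_ : ell T y = ell T z); last first.
    by apply: eq_bigr => i iT; rewrite zy.
  apply: (@walk _ _ T y (fun z => q z = ell T z + a)) => // u i iT qu.
  have [_ _ H] := step _ _ _ iT qu a0; have /andP[y0 ya] := yB i iT; exact: H.
case: (pickP [pred x | q x != ell T x]) => [x /= qx|H]; last first.
  exists 0 => x; rewrite if_same addr0; apply/eqP/negbFE/H.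
pose a := q x + ell T x.
have VE u v : u = v + (u + v) :> V by rewrite addrCA addVV addr0.
have aN u v : u != v :> V -> u + v != 0.
  by apply: contra_neq => uv; rewrite [LHS](VE _ v) uv addr0.
have [xB spr] := spread x a (VE _ _) (aN _ _ qx).
exists a => y; case: ifPn => [/spr //|yB]; rewrite addr0; apply/eqP.
apply: contraNT yB => qy; set b := q y + ell T y.
have [yB spr'] := spread y b (VE _ _) (aN _ _ qy).
suff -> : a = b by [].
(* The constant word of such a [c] lies in both boxes, so its difference from the sum is both [a]
   and [b]. *)
have [c [c0 ca cb]] : exists c : V, [/\ c != 0, c != a & c != b].
  move: a b {spr xB yB spr'} => [[] []] [[] []];
  by [exists (true, true)|exists (false, true)|exists (true, false)].
have cB d : c != d -> boxed T d [ffun=> c].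
  by move=> cd; apply/forall_inP=> i _; rewrite ffunE c0.
have := spr _ (cB _ ca); rewrite (spr' _ (cB _ cb)).
by move/addrI ->.
Qed.

Lemma third_elt (a b t u : V) : a != 0 -> b != 0 -> b != a ->
  t \notin [:: 0; a] -> u \notin [:: 0; a] -> t != u -> u != b -> b = t.
Proof. by move: t u a b; do 4! move=> [[] []]. Qed.

Definition zer (I : finType) (Z : {set I}) (x : {ffun I -> V}) : {ffun I -> V} :=
  [ffun i => if i \in Z then 0 else x i].

Definition const_on (I : finType) (T : {set I}) (b : V) : {ffun I -> V} :=
  [ffun i => if i \in T then b else 0].

Definition axis (I : finType) (i : I) (t : V) : {ffun I -> V} := upd [ffun=> 0] i t.

(* On a line in direction [s] through a point of difference, [q] and [q'] swap two
   values, and this pair does not change when one moves to the other point of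
   difference on a line in another direction.  Zeroing a coordinate therefore
   complements the pair; zeroing all of them identifies it from the axes. *)
Lemma layer_swap_parity (I : finType) (S : {set I}) (s : I) (a : V)
    (q q' : {ffun I -> V} -> V) :
  s \in S -> quasi S q -> quasi S q' -> a != 0 ->
  (forall (x : {ffun I -> V}) i, i \in S -> x i = 0 -> q x = q' x) ->
  (forall x : {ffun I -> V}, x s = a -> q x = q' x) ->
  (forall i t, i \in S -> q (axis i t) = t) ->
  (exists x, q x != q' x) ->
  forall (T : {set I}) b, T \subset S -> b != 0 -> b != a ->
  (q (const_on T b) \in [:: 0; a]) = ~~ odd #|T|.
Proof.
move=> sS [qdep qlat] [q'dep q'lat] a0 qz qa qn [x0 qx0] T b TS b0 ba.
(* These are the values at 0 and [a] on the line in direction [s], the complement of the swapped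
   pair. [D x] says that [x] is a point of difference whose line has this same pair at 0 and [a]. *)
pose p1 := q (upd x0 s 0); pose p2 := q (upd x0 s a).
have p12 : p1 != p2.
  by apply: contra_neq a0 => /(qlat x0 s sS) ->.
pose D x := [/\ q x != q' x, q (upd x s 0) \in [:: p1; p2]
                & q (upd x s a) \in [:: p1; p2]].
have Dx0 : D x0 by split; rewrite // !inE eqxx ?orbT.
have Dnz x i : D x -> i \in S -> x i != 0.
  by case=> + _ _ iS; apply: contra_neq => /(qz x i iS).
have Dsa x : D x -> x s != a.
  by case=> + _ _; apply: contra_neq => /qa.
have step x i : i \in S -> i != s -> D x ->
    exists t, [/\ t != 0, t != x i & D (upd x i t)].
  move=> iS si Dx; have [qx D0 Da] := Dx; have xs0 := Dnz _ _ Dx sS; have xsa := Dsa _ Dx.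
  have xs2 : x s != x s + a.
    by apply: contra_neq a0 => /eqP; rewrite -{1}[x s]addr0 => /eqP/addrI.
  have xs3 : 0 != x s + a.
    apply: contra_neq xsa => /eqP; rewrite eq_sym => /eqP xa.
    by rewrite -[x s]addr0 -(addVV a) addrA xa add0r.
  have xs4 : a != x s + a.
    by apply: contra_neq xs0 => /eqP; rewrite -{1}[a]add0r => /eqP/addIr.
  pose L t u := q (upd (upd x i t) s u).
  have LI t : injective (L t) by apply: qlat.
  have L'I t : injective (L^~ t).
    by move=> v w; rewrite /L !(updC _ _ _ si); apply: qlat.
  pose L' t u := q' (upd (upd x i t) s u).
  have Lx u : L (x i) u = q (upd x s u) by rewrite /L upd_id.
  have ss t : upd (upd x i t) s (x s) = upd x i t.
    by apply/ffunP=> j; rewrite !ffunE; case: (j =P s) => [->|//]; rewrite eq_sym (negbTE si).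
  (* Lines in direction [i] at heights [x s] and [x s + a]: by [line_swap], each value of [q'] on
     the first is the value of [q] on one of the two. *)
  have [|||t||t||t [t0 ti tn tE]] := @two_rows (L^~ (x s)) (L^~ (x s + a)) (L'^~ (x s)) (x i).
  - exact: L'I.
  - exact: L'I.
  - by move=> v w; rewrite /L' !ss; apply: q'lat.
  - by move=> /(LI t)/eqP; apply/negP.
  - by rewrite /L /L' !ss; apply/esym/(qz _ i iS); rewrite upd_same.
  - apply: (@line_swap (L t) (L' t)) => //; first exact: q'lat.
    + by apply: (qz _ s sS); rewrite upd_same.
    + by apply: qa; rewrite upd_same.
  - by rewrite /L /L' upd_id upd_id eq_sym.
  have Lin0 : (L (x i) 0 \in [:: p1; p2]) = (L (x i) a \in [:: p1; p2]).
    by rewrite !Lx D0 Da.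
  have a0' : 0 != a by rewrite eq_sym.
  (* The values at [x s] and [x s + a] lie outside [p1], [p2]. By [tE] the new line has the same two
     values there, so its values at 0 and [a] are again in the pair. *)
  have N1 := pair_compl (LI (x i)) p12 a0' xs0 xsa Lin0.
  have N2 := pair_compl (LI (x i)) p12 a0' _ _ Lin0.
  have {}N2 := N2 (x s + a) _ _.
  rewrite eq_sym xs3 eq_sym xs4 in N2; have {}N2 := N2 isT isT.
  rewrite (Lx 0) D0 /= in N1 N2.
  exists t; split=> //; split.
  - by move: tn; rewrite /L /L' !ss eq_sym.
  - rewrite -/(L t 0) (pair_compl (LI t) p12 xs2) // 1?eq_sym //.
    + by case: tE => -[-> _]; rewrite ?N1 ?N2.
    + by case: tE => -[-> ->]; rewrite ?N1 ?N2.
  - rewrite -/(L t a) (pair_compl (LI t) p12 xs2) // 1?eq_sym //.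
    + by case: tE => -[-> _]; rewrite ?N1 ?N2.
    + by case: tE => -[-> ->]; rewrite ?N1 ?N2.
(* Each zeroed coordinate flips membership: [x i] and its partner [t] are nonzero and by induction
   have equal status, so [pair_compl] gives 0 the opposite one. *)
have claim n : forall Z : {set I}, #|Z| = n -> Z \subset S :\ s -> forall x, D x -> forall u,
    (q (upd (zer Z x) s u) \in [:: p1; p2]) = (u \in [:: 0; a]) (+) odd n.
  elim: n => [|n IH] Z Zn ZS x Dx u.
    have -> : zer Z x = x.
      by apply/ffunP=> i; rewrite ffunE (cards0_eq Zn) inE.
    have [_ D0 Da] := Dx.
    rewrite addbF (_ : (u \in [:: 0; a]) = (u == 0) || (u == a)); last by rewrite !inE.
    case: eqP => [->|/eqP u0] /=; first by [].
    case: eqP => [->|/eqP ua] /=; first by [].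
    rewrite (@pair_compl (fun u => q (upd x s u)) _ _ 0 a) ?D0 ?Da // 1?eq_sym //.
    exact: qlat.
  have [i iZ] : exists i, i \in Z by apply/card_gt0P; rewrite Zn.
  have /setD1P[si iS] := subsetP ZS _ iZ.
  have [t [t0 ti Dy]] := step x i iS si Dx.
  have Z'n : #|Z :\ i| = n by move: Zn; rewrite (cardsD1 i) iZ => -[].
  have Z'S : Z :\ i \subset S :\ s by apply: subset_trans ZS; apply: subsetDl.
  have IHx := IH _ Z'n Z'S _ Dx u; have IHy := IH _ Z'n Z'S _ Dy u.
  pose f t := q (upd (upd (zer (Z :\ i) x) s u) i t).
  have fI : injective f by apply: qlat.
  have f0 : q (upd (zer Z x) s u) = f 0.
    congr q; apply/ffunP=> j; rewrite !ffunE !inE.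
    by case: (j =P s) => [->|_]; [rewrite eq_sym (negbTE si)|case: (j =P i) => [->|//]; rewrite iZ].
  have fx : q (upd (zer (Z :\ i) x) s u) = f (x i).
    congr q; apply/ffunP=> j; rewrite !ffunE !inE.
    by case: (j =P i) => [->|_]; rewrite ?(negbTE si).
  have fy : q (upd (zer (Z :\ i) (upd x i t)) s u) = f t.
    congr q; apply/ffunP=> j; rewrite !ffunE !inE.
    by case: (j =P i) => [->|_]; rewrite ?(negbTE si).
  rewrite f0 (pair_compl fI p12 (_ : x i != t)).
  - by rewrite -fx IHx /= addbN.
  - by rewrite eq_sym.
  - by rewrite eq_sym Dnz.
  - by rewrite eq_sym.
  - by rewrite -fx -fy IHx.
pose m := #|S :\ s|.
(* Zeroing every coordinate but [s] lands on an axis, where [q] is the identity. *)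
have inP v : (v \in [:: p1; p2]) = (v \in [:: 0; a]) (+) odd m.
  rewrite -(claim m (S :\ s) erefl (subxx _) x0 Dx0).
  suff -> : q (upd (zer (S :\ s) x0) s v) = v by [].
  rewrite -[RHS](qn s) //; apply: qdep => i iS; rewrite !ffunE !inE iS andbT.
  by case: (i =P s).
(* Landing on the axis of [i] instead zeroes one coordinate fewer in the claim, so its parity is
   opposite to that of [inP]. *)
have Dbox x i : i \in S -> i != s -> D x -> x i \notin [:: 0; a].
  move=> iS si Dx; have iT : i \in S :\ s by rewrite !inE si.
  have /(_ 0) := claim _ _ erefl (subsetDl (S :\ s) [set i]) x Dx.
  have -> : q (upd (zer (S :\ s :\ i) x) s 0) = x i.
    rewrite -[RHS](qn i) //; apply: qdep => j jS; rewrite !ffunE !inE jS andbT.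
    case: (j =P s) => [->|/eqP js]; first by rewrite eq_sym (negbTE si).
    by case: (j =P i) => [->|].
  rewrite inP mem_head /m (cardsD1 i (S :\ s)) iT /=.
  by case: (x i \in _); case: (odd _).
(* Only two elements lie outside 0 and [a], so either [x i] or its partner is [b]. *)
have [x [Dx xb]] : exists x, D x /\ forall i, i \in S -> i != s -> x i = b.
  pose y : {ffun I -> V} := [ffun=> b].
  exists [ffun i => if i \in S :\ s then y i else x0 i]; split; last first.
    by move=> i iS si; rewrite !ffunE !inE si iS.
  apply: walk Dx0 => x i; rewrite !inE ffunE => /andP[si iS] Dx.
  have [t [t0 ti Dy]] := step x i iS si Dx.
  have := Dbox _ _ iS si Dx; have := Dbox _ _ iS si Dy; rewrite upd_same.
  case: (x i =P b) => [{1}<-|/eqP xb]; first by rewrite upd_id.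
  by move=> tB xB; rewrite (third_elt a0 b0 ba tB xB ti xb).
pose Z := (S :\ s) :\: T; pose u := if s \in T then b else 0.
have := claim _ Z erefl (subsetDl _ _) x Dx u.
have -> : q (upd (zer Z x) s u) = q (const_on T b).
  apply: qdep => i iS; rewrite !ffunE !inE iS andbT.
  case: (i =P s) => [->|/eqP si] //; case: (i \in T) => //=; exact: xb.
rewrite inP; have -> : (u \in [:: 0; a]) = (s \notin T).
  by rewrite /u; case: (s \in T); rewrite !inE ?eqxx // (negbTE b0) (negbTE ba).
have -> : odd m = odd #|Z| (+) odd #|T :\ s|.
  rewrite /m -(cardsID T (S :\ s)) oddD addbC; congr (_ (+) odd #|pred_of_set _|).
  apply/setP=> i; rewrite !inE; case: (boolP (i \in T)) => [/(subsetP TS) -> |]; by rewrite ?andbT ?andbF.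
rewrite (cardsD1 s T) oddD oddb.
by case: (s \in T); case: (odd #|Z|); case: (odd _); case: (q _ \in _).
Qed.

(** * Linearity from constant words, normalization, and the induction *)

Lemma ell_const_on (I : finType) (T : {set I}) (b : V) :
  ell T (const_on T b) = if odd #|T| then b else 0.
Proof.
rewrite /ell (eq_bigr (fun=> b)) => [|i iT]; last by rewrite ffunE iT.
rewrite sumr_const; elim: #|T| => [//|n IH]; rewrite mulrS IH /=.
by case: (odd n); rewrite ?addVV ?addr0.
Qed.

Lemma ell_zer (I : finType) (S T : {set I}) (x : {ffun I -> V}) :
  T \subset S -> ell S (zer (S :\: T) x) = ell T x.
Proof.
move=> TS; rewrite /ell (big_setID T) /= (setIidPr TS) [X in _ + X]big1 => [|i iST].
  by rewrite addr0; apply: eq_bigr => i iT; rewrite ffunE inE iT.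
by rewrite ffunE iST.
Qed.

(** Induction on the face: once the zero faces of the face of [T] are linear, [zero_faces_linear]
    leaves one unknown [a], and the prescribed value at a constant word inside its box forces
    [a = 0]. *)
Lemma const_on_zero_faces (I : finType) (S : {set I}) (q : {ffun I -> V} -> V) :
  quasi S q -> (forall i t, i \in S -> q (axis i t) = t) ->
  (forall (T : {set I}) b, T \proper S -> b != 0 ->
     q (const_on T b) = if odd #|T| then b else 0) ->
  forall (x : {ffun I -> V}) i, i \in S -> x i = 0 -> q x = ell S x.
Proof.
move=> [qdep qlat] qn qc.
have claim n : forall T : {set I}, (#|T| <= n)%N -> T \proper S ->
    forall x : {ffun I -> V}, q (zer (S :\: T) x) = ell T x.
  elim: n => [|n IH] T Tn TS x; have [TS' [s sS sT]] := properP TS.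
    have {Tn} T0 : T = set0 by apply/eqP; rewrite -cards_eq0 -leqn0.
    rewrite T0 /ell big_set0 -(qn s 0 sS); apply: qdep => i iS.
    by rewrite !ffunE !inE iS; case: (i =P s).
  have [T1|T2] := leqP #|T| 1.
    have [T0|/card_gt0P[i iT]] := posnP #|T|; first by apply: IH; rewrite ?T0.
    have -> : T = [set i].
      by apply/esym/eqP; rewrite eqEcard sub1set iT cards1.
    rewrite /ell big_set1 -[RHS](qn i) ?(subsetP TS') //; apply: qdep => j jS.
    by rewrite !ffunE !inE jS andbT; case: (j =P i) => [->|].
  pose qT y := q (zer (S :\: T) y).
  have qTT : quasi T qT.
    split=> [y z yz|y i iT].
      apply: qdep => i iS; rewrite !ffunE inE iS andbT.
      by case: (boolP (i \in T)) => //= /yz.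
    have E t : qT (upd y i t) = q (upd (zer (S :\: T) y) i t).
      by congr q; apply/ffunP=> j; rewrite !ffunE !inE; case: (j =P i) => // ->; rewrite iT.
    by move=> t u; rewrite !E; apply: qlat; apply: (subsetP TS').
  have qT0 (y : {ffun I -> V}) i : i \in T -> y i = 0 -> qT y = ell T y.
    move=> iT yi; have T'S : T :\ i \proper S by apply: sub_proper_trans TS; apply: subsetDl.
    have T'n : (#|T :\ i| <= n)%N by move: Tn; rewrite (cardsD1 i) iT.
    rewrite /ell (bigD1 i) //= yi add0r.
    rewrite (_ : \sum_(j in T | j != i) y j = ell (T :\ i) y); last first.
      by apply: eq_bigl => j; rewrite !inE andbC.
    rewrite -(IH _ T'n T'S y).
    congr q; apply/ffunP=> j; rewrite !ffunE !inE.
    by case: (j =P i) => [->|//]; rewrite iT yi; case: (i \in S).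
  have [a qTa] := zero_faces_linear T2 qTT qT0.
  rewrite -/(qT x) qTa; have [->|a0] := eqVneq a 0; first by rewrite if_same addr0.
  have [b [b0 ba]] : exists b : V, [/\ b != 0 & b != a].
    case: (eqVneq a (true, true)) => [->|?]; first by exists (true, false).
    by exists (true, true); split; rewrite // eq_sym.
  have := qTa (const_on T b); rewrite ell_const_on.
  have -> : qT (const_on T b) = q (const_on T b).
    apply: qdep => i iS; rewrite !ffunE !inE iS andbT; by case: (i \in T).
  have -> : boxed T a (const_on T b).
    by apply/forall_inP=> i iT; rewrite ffunE iT b0.
  rewrite qc //.
  by rewrite -{1}[if _ then _ else _]addr0 => /addrI/esym/eqP; rewrite (negbTE a0).
move=> x i iS xi; have := claim _ (S :\ i) (leqnn _) (properD1 iS) x.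
rewrite -(ell_zer _ (subsetDl S [set i])).
have -> : zer (S :\: (S :\ i)) x = x; last by [].
apply/ffunP=> j; rewrite !ffunE !inE; case: (j =P i) => [->|_]; first by rewrite iS.
by case: (j \in S).
Qed.

(** An extension is determined by the constant of [zero_faces_linear], which has four possible
    values. *)
Lemma linear_pigeonhole (I : finType) (S : {set I}) (F : 'I_5 -> {ffun I -> V} -> V) :
  (1 < #|S|)%N -> (forall k, quasi S (F k)) ->
  (forall k (x : {ffun I -> V}) i, i \in S -> x i = 0 -> F k x = ell S x) ->
  exists k l, k != l /\ forall x, F k x = F l x.
Proof.
move=> S2 Fq F0.
have /fin_all_exists[a Fa] k := zero_faces_linear S2 (Fq k) (F0 k).
have /injectivePn[k [l kl akl]] : ~~ injectiveb a.
  by apply/injectiveP=> /leq_card; rewrite card_ord card_prod card_bool.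
by exists k, l; split=> // x; rewrite !Fa akl.
Qed.

(** As [S] has a second coordinate, axis words lie in zero faces, where all [F k] agree; inverting
    the axis permutations of [F k0] therefore normalizes all of them at once. *)
Lemma normalize_axes (I : finType) (S : {set I}) (K : Type) (k0 : K)
    (F : K -> {ffun I -> V} -> V) :
  (1 < #|S|)%N -> (forall k, quasi S (F k)) ->
  (forall k l (x : {ffun I -> V}) i, i \in S -> x i = 0 -> F k x = F l x) ->
  exists G : K -> {ffun I -> V} -> V,
  [/\ forall k, quasi S (G k),
      forall k l (x : {ffun I -> V}) i, i \in S -> x i = 0 -> G k x = G l x,
      forall k i t, i \in S -> G k (axis i t) = t
    & forall k l, (forall x, G k x = G l x) -> forall x, F k x = F l x].
Proof.
move=> S2 Fq F0; pose c := F k0 [ffun=> 0].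
pose g i t := F k0 (axis i t) + c.
have gI i : i \in S -> injective (g i).
  by move=> iS u v /addIr; apply: (Fq k0).2.
have g0 i : g i 0 = 0.
  rewrite /g (_ : axis i 0 = [ffun=> 0]) ?addVV //.
  by apply/ffunP=> j; rewrite !ffunE if_same.
(* The inverse of [g i]; the default 0 is never reached, since [g i] is onto. *)
pose h i t := if i \in S then odflt 0 [pick u | g i u == t] else t.
have hK i t : i \in S -> g i (h i t) = t.
  move=> iS; rewrite /h iS; case: pickP => [u /eqP //|N].
  have /imsetP[u _ tu] : t \in g i @: setT.
    have -> : g i @: setT = setT; last by rewrite inE.
    by apply/eqP; rewrite eqEcard subsetT card_imset ?leqnn //; apply: gI.
  by have := N u; rewrite /= tu eqxx.
have hI i : injective (h i).
  case: (boolP (i \in S)) => iS u v; last by rewrite /h (negbTE iS).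
  by move=> uv; rewrite -(hK _ u iS) uv hK.
have h0 i : h i 0 = 0.
  case: (boolP (i \in S)) => iS; last by rewrite /h (negbTE iS).
  by apply: (gI _ iS); rewrite hK ?g0.
pose hx (x : {ffun I -> V}) : {ffun I -> V} := [ffun i => h i (x i)].
have hu x i t : hx (upd x i t) = upd (hx x) i (h i t).
  by apply/ffunP=> j; rewrite !ffunE; case: (j =P i) => [->|].
have ha i t : hx (axis i t) = axis i (h i t).
  by rewrite hu; congr upd; apply/ffunP=> j; rewrite !ffunE.
exists (fun k x => F k (hx x) + c); split.
- move=> k; split=> [x y xy|x i iS u v].
    by congr (_ + c); apply: (Fq k).1 => i iS; rewrite !ffunE xy.
  by rewrite !hu => /addIr /(Fq k).2 - /(_ iS) /hI.
- move=> k l x i iS xi; congr (_ + c); apply: (F0 k l _ i iS).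
  by rewrite ffunE xi.
- move=> k i t iS; rewrite ha; have [j jS ji] := other_elt i S2.
  by rewrite (F0 k k0 _ j) ?upd_other ?ffunE // -[LHS]/(g i (h i t)) hK.
move=> k l E x; pose y : {ffun I -> V} := [ffun i => g i (x i)].
have hy : {in S, hx y =1 x}.
  by move=> i iS; rewrite !ffunE; apply: (gI _ iS); rewrite hK.
by have := E y; move/addIr; rewrite ((Fq k).1 _ _ hy) ((Fq l).1 _ _ hy).
Qed.

Lemma five_extensions (I : finType) (S : {set I}) (F : 'I_5 -> {ffun I -> V} -> V) :
  (1 < #|S|)%N -> (forall k, quasi S (F k)) ->
  (forall k l (x : {ffun I -> V}) i, i \in S -> x i = 0 -> F k x = F l x) ->
  exists k l, k != l /\ forall x, F k x = F l x.
Proof.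
have [n] := ubnP #|S|; elim: n => // n IH in S F *; rewrite ltnS => Sn S2 Fq F0.
have [G [Gq G0 Gn GF]] := normalize_axes ord0 S2 Fq F0.
suff [k [l [kl /GF H]]] : exists k l, k != l /\ forall x, G k x = G l x.
  by exists k, l.
(* Here a proper subset has at most one element, so its constant words lie on axes and their values
   are already normalized. *)
have [S3|S3] := leqP #|S| 2.
  apply: (linear_pigeonhole S2 Gq) => k x i iS xi.
  apply: (const_on_zero_faces (Gq k) (Gn k) _ iS xi) => T b TS b0.
  have [TS' [s sS sT]] := properP TS.
  have T1 : (#|T| <= 1)%N by rewrite -ltnS (leq_trans (proper_card TS)).
  have [T0|/card_gt0P[j jT]] := posnP #|T|.
    rewrite T0 /= -[RHS](Gn k s) //; apply: (Gq k).1 => j jS.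
    by rewrite !ffunE (cards0_eq T0) inE if_same.
  have -> : T = [set j] by apply/esym/eqP; rewrite eqEcard sub1set jT cards1.
  rewrite cards1 /= -[RHS](Gn k j) ?(subsetP TS') //; apply: (Gq k).1 => i' _.
  by rewrite !ffunE !inE.
case: (pickP [pred kl : 'I_5 * 'I_5 | (kl.1 != kl.2) && [forall x, G kl.1 x == G kl.2 x]]).
  by move=> [k l] /= /andP[kl /forallP E]; exists k, l; split=> // x; apply/eqP.
move=> N; have /card_gt0P[s sS] : (0 < #|S|)%N by apply: ltnW.
apply: (linear_pigeonhole S2 Gq) => k x i iS xi.
apply: (const_on_zero_faces (Gq k) (Gn k) _ iS xi) => T b TS b0.
have [TS' [z zS zT]] := properP TS.
have S1 : (#|S :\ s| < #|S|)%N by rewrite [X in (_ < X)%N](cardsD1 s) sS.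
have par a : a != 0 -> b != a -> (G k (const_on T b) \in [:: 0; a]) = ~~ odd #|T|.
  move=> a0 ba.
  (* Two of the five agree on the layer of [a], yet by [N] they differ somewhere. *)
  have [||||l [m [lm E]]] := IH (S :\ s) (fun k x => G k (upd x s a)).
  - exact: leq_trans S1 _.
  - by move: S3; rewrite (cardsD1 s) sS.
  - move=> l; split=> [y w yw|y j].
      apply: (Gq l).1 => j jS; rewrite !ffunE; case: (j =P s) => // /eqP js.
      by apply: yw; rewrite !inE js.
    rewrite !inE => /andP[js jS] u v; rewrite !(updC _ _ _ js).
    exact: (Gq l).2.
  - move=> l m y j; rewrite !inE => /andP[js jS] yj.
    by apply: (G0 l m _ j jS); rewrite upd_other.
  have D : exists x, G l x != G m x.
    have := N (l, m); rewrite /= lm => /negbT; rewrite negb_forall => /existsP[y ylm].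
    by exists y.
  (* The word vanishes at [z], so [k] may be traded for [l]. *)
  rewrite (G0 k l _ z zS) ?ffunE ?(negbTE zT) //.
  apply: (layer_swap_parity sS (Gq l) (Gq m) a0 (G0 l m) _ (Gn l) D TS' b0 ba).
  by move=> y ys; have := E y; rewrite -ys upd_id.
(* [a] and [a + b] are the nonzero elements other than [b]. Lying in both pairs forces the value 0,
   lying in neither forces [b]. *)
have [a [a0 ba ab0]] : exists a, [/\ a != 0, b != a & b != a + b].
  case: (eqVneq b (true, true)) => [->|bt]; first by exists (true, false).
  exists (true, true); split=> //; by move: b b0 bt {par} => [[] []].
have ab1 : a + b != 0.
  by apply: contra_neq ba => /eqP; move: a b {a0 b0 ab0 par} => [[] []] [[] []].
move: (par a a0 ba) (par _ ab1 ab0).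
move: (G k _) (odd _) => v o; move: a b a0 b0 ba ab0 ab1 {par}.
by move: o v => [] [[] []] [[] []] [[] []].
Qed.

(** * Counting restrictions support by support *)

Local Open Scope nat_scope.

Lemma card_le_fibers (T1 T2 : finType) (A : {set T1}) (f : T1 -> T2) (k : nat) :
  (forall z, #|[set y in A | f y == z]| <= k) -> #|A| <= k * #|f @: A|.
Proof.
move=> H; rewrite -sum1_card (partition_big_imset f) /= mulnC -sum_nat_const.
by apply: leq_sum => z _; rewrite sum1dep_card.
Qed.

Lemma inj_agree (T : finType) (f g : T -> T) (t : T) : injective f -> injective g ->
  (forall u, u != t -> f u = g u) -> f t = g t.
Proof.
move=> fI gI fg; have [h _ gh] := injF_bij gI.
have [ht|/fg] := eqVneq (h (f t)) t; first by rewrite -{2}ht gh.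
by rewrite gh => /fI ht; rewrite -{2}ht gh.
Qed.

Lemma card_distinct_pairs (T : finType) (v : T) :
  #|[set p : T * T | [&& p.1 != v, p.2 != v & p.2 != p.1]]| = #|T|.-1 * #|T|.-2.
Proof.
rewrite -sum1dep_card -(pair_big_dep (fun u => u != v) (fun u w => (w != v) && (w != u))
  (fun _ _ => 1)) /=.
rewrite (eq_bigr (fun=> #|T|.-2)) => [|u uv].
  by rewrite sum_nat_const cardC1.
rewrite sum1dep_card -[#|T|](cardC (pred2 v u)) card2 eq_sym uv /=.
by apply: eq_card => w; rewrite !inE negb_or.
Qed.

(** Binary digits; [ord0] corresponds to 0, so supports match nonzero coordinates. *)
Definition enc (k : 'I_4) : V := (1 < k, odd k).
Definition dec (v : V) : 'I_4 := inord (v.1.*2 + v.2).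

Lemma decK : cancel dec enc.
Proof. by move=> [[] []]; rewrite /enc /dec inordK. Qed.

Lemma encK : cancel enc dec.
Proof.
by case=> [[|[|[|[|//]]]] lt_k]; apply: val_inj; rewrite /= inordK.
Qed.

Lemma dec0 : dec 0%R = ord0.
Proof. by apply: val_inj; rewrite /= inordK. Qed.

Definition supp (n : nat) (x : word n) : {set 'I_n} := [set i | x i != ord0].

Definition quasigroups (n : nat) : {set {ffun word n -> 'I_4}} :=
  [set q | is_quasigroup q].

Lemma quasigroups_inj (n : nat) (q : {ffun word n -> 'I_4}) (x : word n) (i : 'I_n) :
  q \in quasigroups n -> injective (fun t => q (upd x i t)).
Proof.
rewrite inE => /forallP H s t; apply: contra_eq => st.
have /forallP/(_ (upd x i t))/implyP := H (upd x i s); apply.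
rewrite /differ_in_one (_ : [set j | _] = [set i]) ?cards1 //.
apply/setP=> j; rewrite !inE !ffunE; case: (j =P i) => // _.
by rewrite eqxx.
Qed.

(* Functions are restricted to the words with support in [F] by resetting
   all other values, so that restrictions stay in the same finite type. *)
Definition res (n : nat) (F : {set {set 'I_n}}) (q : {ffun word n -> 'I_4}) :
    {ffun word n -> 'I_4} :=
  [ffun x => if supp x \in F then q x else ord0].

Lemma res_sub (n : nat) (F G : {set {set 'I_n}}) (q : {ffun word n -> 'I_4}) :
  G \subset F -> res G (res F q) = res G q.
Proof.
move=> GF; apply/ffunP=> x; rewrite !ffunE.
by case: (boolP (_ \in G)) => // /(subsetP GF) ->.
Qed.

Lemma res_eq_supp (n : nat) (F : {set {set 'I_n}}) (T : {set 'I_n})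
    (q q' : {ffun word n -> 'I_4}) :
  res (F :\ T) q = res (F :\ T) q' -> (forall x, supp x = T -> q x = q' x) ->
  res F q = res F q'.
Proof.
move=> E H; apply/ffunP=> x; rewrite !ffunE; case: ifP => // xF.
have [/H //|xT] := eqVneq (supp x) T.
by move/ffunP/(_ x): E; rewrite !ffunE !inE xF xT.
Qed.

Definition choices (n : nat) (T : {set 'I_n}) : nat := if #|T| == 1 then 6 else 4.


Lemma restriction_fiber (n : nat) (F : {set {set 'I_n}}) (T : {set 'I_n}) z
    (y y' : {ffun word n -> 'I_4}) :
  y \in [set y in res F @: quasigroups n | res (F :\ T) y == z] ->
  y' \in [set y in res F @: quasigroups n | res (F :\ T) y == z] ->
  (forall x, supp x = T -> y x = y' x) -> y = y'.
Proof.
rewrite !inE => /andP[/imsetP[q _ ->] /eqP yz] /andP[/imsetP[q' _ ->] /eqP y'z] yy'.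
rewrite -(res_sub q (subxx F)) -(res_sub q' (subxx F)).
by apply: (@res_eq_supp _ _ T); rewrite ?yz ?y'z.
Qed.

Lemma supp0 (n : nat) : supp [ffun=> ord0 : 'I_4] = set0 :> {set 'I_n}.
Proof. by apply/setP=> i; rewrite !inE ffunE. Qed.

Lemma supp_eq0 (n : nat) (x : word n) : supp x = set0 -> x = [ffun=> ord0].
Proof.
move=> x0; apply/ffunP=> i; rewrite ffunE; apply/eqP; move/setP/(_ i): x0.
by rewrite !inE => /negbFE.
Qed.

Lemma fiber_set0 (n : nat) (F : {set {set 'I_n}}) z :
  #|[set y in res F @: quasigroups n | res (F :\ set0) y == z]| <= 4.
Proof.
rewrite -[X in _ <= X]card_ord.
rewrite -(@card_in_imset _ _ (fun y : {ffun word n -> 'I_4} => y [ffun=> ord0])).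
  exact: max_card.
move=> y y' yA y'A E; apply: (restriction_fiber yA y'A) => x.
by move/supp_eq0 ->.
Qed.

(** On the axis of [i] there is a permutation whose value at 0 is given by [z]; its values at 1 and
    2 determine the one at 3, leaving 3 * 2 choices. *)
Lemma fiber_set1 (n : nat) (F : {set {set 'I_n}}) (i : 'I_n) z :
  [set i] \in F -> set0 \in F ->
  #|[set y in res F @: quasigroups n | res (F :\ [set i]) y == z]| <= 6.
Proof.
move=> iF F0; set A := [set y in _ | _].
pose ax (t : 'I_4) : word n := upd [ffun=> ord0] i t.
have ax0 : ax ord0 = [ffun=> ord0].
  by apply/ffunP=> j; rewrite !ffunE if_same.
have axF t : supp (ax t) \in F.
  have [->|t0] := eqVneq t ord0; first by rewrite ax0 supp0.
  rewrite (_ : supp _ = [set i]) //; apply/setP=> j; rewrite !inE !ffunE.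
  by case: (j =P i).
have AI y : y \in A -> injective (fun t => y (ax t)).
  rewrite inE => /andP[/imsetP[q qQ ->] _] s t; rewrite !ffunE !axF.
  by move/(quasigroups_inj qQ).
have A0 y : y \in A -> y (ax ord0) = z (ax ord0).
  rewrite inE => /andP[_ /eqP <-]; rewrite ffunE ax0 supp0 !inE F0 andbT.
  by rewrite eq_sym -cards_eq0 cards1.
pose v := z (ax ord0).
pose f (y : {ffun word n -> 'I_4}) := (y (ax (inord 1)), y (ax (inord 2))).
have fI : {in A &, injective f}.
  move=> y y' yA y'A [E1 E2]; apply: (restriction_fiber yA y'A) => x xi.
  have -> : x = ax (x i).
    apply/ffunP=> j; rewrite !ffunE; case: (j =P i) => [->//|/eqP ji].
    by apply/eqP; move/setP/(_ j): xi; rewrite !inE (negbTE ji) => /negbFE.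
  have E u : u != inord 3 -> y (ax u) = y' (ax u).
    case: u => [[|[|[|[|//]]]] lt_u] u3.
    - by rewrite (_ : Ordinal lt_u = ord0) ?A0 //; apply: val_inj.
    - by rewrite (_ : Ordinal lt_u = inord 1) //; apply: val_inj; rewrite /= inordK.
    - by rewrite (_ : Ordinal lt_u = inord 2) //; apply: val_inj; rewrite /= inordK.
    - by case/eqP: u3; apply: val_inj; rewrite /= inordK.
  have [->|/E //] := eqVneq (x i) (inord 3).
  exact: (inj_agree (AI y yA) (AI y' y'A) E).
rewrite -(card_in_imset fI).
have <- : #|[set p : 'I_4 * 'I_4 | [&& p.1 != v, p.2 != v & p.2 != p.1]]| = 6.
  by rewrite card_distinct_pairs card_ord.
apply/subset_leq_card/subsetP=> p /imsetP[y yA ->]; rewrite inE /= /v -(A0 y yA).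
by rewrite !(inj_eq (AI y yA)) -!val_eqE /= !inordK.
Qed.

(** Five members of the fiber, read over [V] on words supported in [T], agree on the zero faces
    because smaller supports are governed by [z]; [five_extensions] then makes two coincide. *)
Lemma fiber_large (n : nat) (F : {set {set 'I_n}}) (T : {set 'I_n}) z :
  (forall U W : {set 'I_n}, U \in F -> W \subset U -> W \in F) -> T \in F -> 1 < #|T| ->
  #|[set y in res F @: quasigroups n | res (F :\ T) y == z]| <= 4.
Proof.
move=> Fdown TF T2; set A := [set y in _ | _]; rewrite leqNgt; apply/negP=> A5.
pose Y (k : 'I_5) := enum_val (widen_ord A5 k).
have YA k : Y k \in A by apply: enum_valP.
have YI k l : k != l -> Y k != Y l.
  by apply: contra_neq => /enum_val_inj /(congr1 val) /= kl; apply: val_inj.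
pose w (x : {ffun 'I_n -> V}) : word n := [ffun i => if i \in T then dec (x i) else ord0].
have wT x : supp (w x) \subset T.
  by apply/subsetP=> i; rewrite inE ffunE; case: (i \in T).
have wF x : supp (w x) \in F by apply: Fdown TF (wT x).
have [|| k [l [kl E]]] := @five_extensions _ T (fun k x => enc (Y k (w x))) T2.
- move=> k; split=> [x x' xx'|x i iT s t].
    congr (enc (Y k _)); apply/ffunP=> i; rewrite !ffunE.
    by case: (boolP (i \in T)) => // /xx' ->.
  have wu u : w (upd x i u) = upd (w x) i (dec u).
    by apply/ffunP=> j; rewrite !ffunE; case: (j =P i) => [->|//]; rewrite iT.
  move=> /(can_inj encK); have := wF (upd x i s); have := wF (upd x i t).
  have := YA k; rewrite inE => /andP[/imsetP[q qQ ->] _].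
  rewrite !ffunE => -> ->; rewrite !wu.
  by move/(quasigroups_inj qQ)/(can_inj decK).
- move=> k l x i iT xi; congr enc.
  have YE m : Y m (w x) = z (w x).
    have := YA m; rewrite inE => /andP[_ /eqP <-]; rewrite ffunE !inE wF andbT.
    rewrite ifT //; apply: contraTneq iT => <-.
    by rewrite inE ffunE xi dec0 if_same eqxx.
  by rewrite !YE.
case/eqP: (YI k l kl); apply: (restriction_fiber (YA k) (YA l)) => x xT.
have -> : x = w [ffun i => enc (x i)].
  apply/ffunP=> i; rewrite !ffunE encK -{1}xT inE.
  by case: eqP.
exact: can_inj encK _ _ (E _).
Qed.

Lemma card_restrictions (n : nat) (F : {set {set 'I_n}}) :
  (forall U W : {set 'I_n}, U \in F -> W \subset U -> W \in F) ->
  #|res F @: quasigroups n| <= \prod_(T in F) choices T.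
Proof.
have [m] := ubnP #|F|; elim: m => // m IH in F *; rewrite ltnS => Fm Fdown.
have [->|[T0 T0F]] := set_0Vmem F.
  rewrite big_set0; pose o : {ffun word n -> 'I_4} := [ffun=> ord0].
  apply: leq_trans (_ : #|[set o]| <= 1); last by rewrite cards1.
  apply/subset_leq_card/subsetP=> y /imsetP[q _ ->]; rewrite inE.
  by apply/eqP/ffunP=> x; rewrite !ffunE inE.
(* Removing a set of maximal size keeps the family closed under subsets. *)
case: (@arg_maxnP _ T0 (mem F) (fun T => #|T|) T0F) => T.
rewrite [mem F T]topredE => TF Tmax.
have F'down (U W : {set 'I_n}) : U \in F :\ T -> W \subset U -> W \in F :\ T.
  rewrite !inE => /andP[UT UF] WU; rewrite (Fdown U W UF WU) andbT.
  apply: contra UT => /eqP WT; rewrite eq_sym eqEcard -{1}WT WU.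
  exact: Tmax.
have F'm : #|F :\ T| < m by apply: leq_trans Fm; rewrite [X in _ < X](cardsD1 T) TF.
rewrite (big_setD1 T TF) /=; apply: leq_trans (leq_mul (leqnn _) (IH _ F'm F'down)).
have -> : res (F :\ T) @: quasigroups n = res (F :\ T) @: (res F @: quasigroups n).
  rewrite -imset_comp; apply: eq_imset => q /=; rewrite res_sub //; exact: subD1set.
apply: card_le_fibers => z; rewrite /choices.
case: (ltngtP #|T| 1) => [|T2|/eqP/cards1P[i Ti]].
- by rewrite ltnS leqn0 cards_eq0 => /eqP ->; apply: fiber_set0.
- exact: fiber_large.
- by rewrite Ti in TF *; apply: fiber_set1 => //; apply: Fdown TF (sub0set _).
Qed.

Lemma prod_choices (n : nat) :
  \prod_(T in [set: {set 'I_n}]) choices T = 6 ^ n * 4 ^ (2 ^ n - n).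
Proof.
rewrite (bigID (fun T : {set 'I_n} => #|T| == 1)) /=.
rewrite (eq_bigr (fun=> 6)) => [|T /andP[_ T1]]; last by rewrite /choices T1.
rewrite [X in _ * X = _](eq_bigr (fun=> 4)) => [|T /andP[_ /negbTE T1]]; last first.
  by rewrite /choices T1.
have c1 : #|[set T : {set 'I_n} | #|T| == 1]| = n by rewrite card_draws card_ord bin1.
have c2 : #|~: [set T : {set 'I_n} | #|T| == 1]| = 2 ^ n - n.
  by rewrite cardsCs setCK c1 -cardsT -powersetT card_powerset cardsT card_ord.
rewrite !prod_nat_const; congr (6 ^ _ * 4 ^ _).
  by rewrite -[RHS]c1; apply: eq_card => T; rewrite unfold_in !inE.
by rewrite -[RHS]c2; apply: eq_card => T; rewrite unfold_in !inE.
Qed.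

Lemma card_quasigroups_le (n : nat) : Q n <= 4 * 6 ^ n * 4 ^ (2 ^ n - n - 1).
Proof.
have n2 : 0 < 2 ^ n - n by rewrite subn_gt0 ltn_expl.
(* The leading 4, the choice at empty support, is absorbed into the power of 4. *)
rewrite [4 * _]mulnC -mulnA -expnS subn1 prednK // -prod_choices.
apply: leq_trans (card_restrictions _) => [|U W _ _]; last by rewrite inE.
rewrite (_ : _ @: _ = quasigroups n) // -[RHS]imset_id; apply: eq_imset => q.
by apply/ffunP=> x; rewrite ffunE inE.
Qed.

(* Asymptotics of the bound *)
From mathcomp Require Import all_classical all_reals all_analysis.
From mathcomp Require Import ring.
Import numFieldNormedType.Exports.
Local Open Scope classical_set_scope.
Local Open Scope ring_scope.

Theorem mainTheorem4 (R : realType) :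
  (forall n : nat, (1 <= n)%N ->
     (Q n <= 4 * 6 ^ n * 4 ^ (2 ^ n - n - 1))%N)
  /\
  (exists e : nat -> R,
     e =O_\oo (fun n : nat => n%:R : R) /\
     forall n : nat, (1 <= n)%N ->
       (4 * 6 ^ n * 4 ^ (2 ^ n - n - 1))%N%:R = 2 `^ (2 ^+ n.+1 + e n) :> R).
Proof.
split=> [n _|]; first exact: card_quasigroups_le.
(* The base 2 logarithm of 3/2, so that the error term is exactly [n * c]. *)
pose c : R := ln (3 / 2) / ln 2.
have ln2 : ln 2 != 0 :> R by rewrite gt_eqF // ln_gt0 ?ltr1n.
have c2 : 2 `^ c = 3 / 2.
  by rewrite /powR pnatr_eq0 /= /c divfK // lnK // posrE divr_gt0.
exists (fun n => n%:R * c); split.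
  (* Any constant [k] at least the absolute value of [c] works. *)
  apply/eqOP; near=> k; near=> n.
  rewrite normrM mulrC ler_wpM2r //; near: k; exact: nbhs_pinfty_ge.
move=> n _.
have n2 : (0 < 2 ^ n - n)%N by rewrite subn_gt0 ltn_expl.
have cardE : (4 * 6 ^ n * 4 ^ (2 ^ n - n - 1) = 6 ^ n * 4 ^ (2 ^ n - n))%N.
  by rewrite [(4 * _)%N]mulnC -mulnA -expnS subn1 prednK.
rewrite cardE powRD ?pnatr_eq0 ?implybT // [n%:R * c]mulrC powRrM c2.
rewrite powR_mulrn ?divr_ge0 // -natrX powR_mulrn // expnS.
(* This removes the truncated subtraction; what remains is that 4 times 3/2 is 6. *)
have [m mE] : exists m, (2 ^ n = m + n)%N.
  by exists (2 ^ n - n)%N; rewrite subnK //; apply: ltnW; apply: ltn_expl.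
have e4 : 2 ^+ 2 = 4 :> R by rewrite -natrX.
have e6 : 4 * (3 / 2) = 6 :> R by field.
rewrite mE addnK natrM !natrX.
by rewrite exprM e4 exprD -mulrA -exprMn e6 mulrC.
Unshelve. all: by end_near.
Qed.
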